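(* Let $m,n,p\ge3$, let $A=W_m(a,c,b,d)$, $B=W_n(a,b,c,d)$ (states $q_0,\dots,q_{n-1}$), $C=W_p(d,b,c,a)$ (states $r_0,\dots,r_{p-1}$), and let $D$ be the automaton built from them. Let $(i_1,S_1)\neq(i_2,S_2)$ be two states of $D$ such that $S_1,S_2$ are saturated tableaux and, for $k=1,2$, $(q_0,r_0)\in S_k$ whenever $i_k=m-1$. Then $(i_1,S_1)$ and $(i_2,S_2)$ are not equivalent, i.e. there is a word $w\in\Sigma^*$ such that exactly one of $(i_1,S_1)\cdot w$, $(i_2,S_2)\cdot w$ lies in $F_D$.
   Context: Alphabet $\Sigma=\{a,b,c,d\}$. For distinct symbols $x_1,x_2,x_3,x_4$, $W_k(x_1,x_2,x_3,x_4)$ is the complete DFA with states $\{0,\dots,k-1\}$, initial state $0$, unique final state $k-1$, where $x_1$ acts as the cycle $j\mapsto j+1\bmod k$, $x_2$ swaps $k-2$ and $k-1$, $x_3$ sends $1$ to $0$ and fixes the others, and $x_4$ is the identity. Automaton $D$: states $Q_A\times 2^{Q_B\times Q_C}$, initial state $(0,\emptyset)$; $(i,S)\in F_D$ iff $S$ contains $(q,r)$ with exactly one of $q$ final in $B$, $r$ final in $C$; $(i,S)\cdot x=(i\cdot x,S\cdot x)$ if $i\cdot x$ is not final in $A$, and $(i\cdot x,S\cdot x\cup\{(q_0,r_0)\})$ otherwise, where $S\cdot x=\{(q\cdot x,r\cdot x):(q,r)\in S\}$. A tableau $S\subseteq Q_B\times Q_C$ is saturated if whenever $(q_x,r_{x'}),(q_x,r_{y'}),(q_y,r_{y'})\in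 S$ then $(q_y,r_{x'})\in S$. *)

(* Defs.v *)
From HB Require Import structures.
From mathcomp Require Import all_boot.
Set Implicit Arguments. Unset Strict Implicit. Unset Printing Implicit Defensive.

Inductive letter := La | Lb | Lc | Ld.

Definition letter_eqb (x y : letter) : bool :=
  match x, y with
  | La, La | Lb, Lb | Lc, Lc | Ld, Ld => true
  | _, _ => false
  end.

Lemma letter_eqP : Equality.axiom letter_eqb.
Proof. by case; case; constructor. Qed.

HB.instance Definition _ := hasDecEq.Build letter letter_eqP.

(* Transition of W_k(x1,x2,x3,x4) on natural-number states:
   x1 : j |-> j+1 mod k ; x2 : swaps k-2 and k-1 ; x3 : 1 |-> 0, fixes others;
   x4 : identity. (The x_i are distinct and exhaust Sigma.) *)
Definition wnat (k : nat) (x1 x2 x3 x4 : letter) (j : nat) (x : letter) : nat :=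
  if x == x1 then j.+1 %% k
  else if x == x2 then (if j == k - 2 then k - 1 else if j == k - 1 then k - 2 else j)
  else if x == x3 then (if j == 1 then 0 else j)
  else if x == x4 then j
  else j.

Lemma wnat_lt k x1 x2 x3 x4 j x : j < k -> wnat k x1 x2 x3 x4 j x < k.
Proof.
move=> hj; have k0 : 0 < k by apply: leq_ltn_trans hj.
rewrite /wnat.
case: (x == x1); first by rewrite ltn_pmod.
case: (x == x2).
  case: (j == k - 2); first by rewrite ltn_subrL k0.
  case: (j == k - 1); last by [].
  by case: k k0 {hj} => // k _; rewrite subSS ltnS leq_subr.
case: (x == x3); first by case: (j == 1).
by case: (x == x4).
Qed.

Definition Wdelta (k : nat) (x1 x2 x3 x4 : letter) (j : 'I_k) (x : letter) : 'I_k :=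
  Ordinal (wnat_lt x1 x2 x3 x4 x (ltn_ord j)).

Definition Wfinal (k : nat) (j : 'I_k) : bool := val j == k - 1.

Definition dA (m : nat) := @Wdelta m La Lc Lb Ld.
Definition dB (n : nat) := @Wdelta n La Lb Lc Ld.
Definition dC (p : nat) := @Wdelta p Ld Lb Lc La.

Definition init_pair (n p : nat) : {set 'I_n * 'I_p} :=
  [set u : 'I_n * 'I_p | (val u.1 == 0) && (val u.2 == 0)].

Definition Dstate (m n p : nat) : Type := ('I_m * {set 'I_n * 'I_p})%type.

Definition Dstep (m n p : nat) (st : Dstate m n p) (x : letter) : Dstate m n p :=
  let i' := dA st.1 x in
  let S' := [set (dB u.1 x, dC u.2 x) | u in st.2] in
  (i', if Wfinal i' then S' :|: init_pair n p else S').

Definition Drun (m n p : nat) (st : Dstate m n p) (w : seq letter) : Dstate m n p :=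
  foldl (@Dstep m n p) st w.

Definition Dfinal (m n p : nat) (st : Dstate m n p) : bool :=
  [exists u in st.2, Wfinal u.1 (+) Wfinal u.2].

Definition saturated (n p : nat) (S : {set 'I_n * 'I_p}) : Prop :=
  forall (qx qy : 'I_n) (rx ry : 'I_p),
    (qx, rx) \in S -> (qx, ry) \in S -> (qy, ry) \in S -> (qy, rx) \in S.

(* Main.v *)
Require Import Defs.
From mathcomp Require Import all_boot.
From mathcomp Require Import zify.
Set Implicit Arguments. Unset Strict Implicit. Unset Printing Implicit Defensive.

(* Colour a state q of B (resp. r of C) by whether the word w leads it to the
   final state.  A state (i,S) of D accepts w iff some (q,r) in S has two
   different colours, or some pair (q_0,r_0) added while reading w gets two
   different colours from the remaining suffix of w.

   If i_1 <> i_2, read a^k c a^(n-1): the letter c empties row 1, which then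
   becomes row 0, so after this word (q_0,r_0) is the only possible pair in
   row 0, and it is present iff A has just reached its final state.  As a and c
   permute the states of A, a suitable k makes this happen for i_1 only.  The
   word a^(n-1) c d^(p-2) then accepts exactly the pairs of row 0.

   If i_1 = i_2 and (q,r) is in S_1 but not in S_2, saturation of S_2 gives a
   colouring of rows and columns that agrees on S_2 and separates q from r.
   Every pair of colourings (s,t) is the pullback of the final ones along some
   word: at level 0 of A, a and d rotate s and t independently, b swaps two
   neighbours in both, and commutators of a and b give 3-cycles of s alone.
   Since binary words of length at least 3 have repeated letters, 3-cycles
   already reach every permutation of s, and then the merging letter c allows
   any entry to be overwritten by another one. *)

(** * Binary words under rotations, swaps and copies *)

Definition preserves_rot (Q : seq bool -> Prop) : Prop :=
  forall s, Q s -> Q (rot 1 s).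

Lemma preserves_rotn Q k s : preserves_rot Q -> Q s -> Q (rot k s).
Proof.
move=> rotQ Qs; have [le_k|/ltnW /rot_oversize -> //] := leqP k (size s).
by elim: k le_k => [|k IHk] le_k; rewrite ?rot0 // rotS //; apply/rotQ/IHk/ltnW.
Qed.

Lemma preserves_rot_cat Q s1 s2 : preserves_rot Q -> Q (s1 ++ s2) -> Q (s2 ++ s1).
Proof. by move=> rotQ /(preserves_rotn (size s1) rotQ); rewrite rot_size_cat. Qed.

(** Conjugating the swap of the first two letters by rotations gives every adjacent swap, and these
    generate all permutations. *)
Lemma preserves_perm (Q : seq bool -> Prop) s1 s2 :
  preserves_rot Q -> (forall x y s, Q (x :: y :: s) -> Q (y :: x :: s)) ->
  perm_eq s1 s2 -> Q s1 -> Q s2.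
Proof.
move=> rotQ swapQ.
have adjQ l x y r : Q (l ++ x :: y :: r) -> Q (l ++ y :: x :: r).
  move=> /(preserves_rot_cat rotQ) /swapQ Q'.
  exact: (@preserves_rot_cat Q (y :: x :: r)).
have consQ x l l1 r : Q (l ++ x :: l1 ++ r) -> Q (l ++ l1 ++ x :: r).
  elim: l1 l => [|y l1 IH] l //= /adjQ Q'.
  by have := IH (rcons l y); rewrite !cat_rcons; apply.
apply: catCA_perm_ind => l1 l2 l3.
elim: l1 l2 l3 => [|x l1 IH] l2 l3 // /(consQ x [::] l1) Q'.
exact: (consQ x [::] l2 (l1 ++ l3)) (IH (x :: l2) l3 Q').
Qed.

(** The clauses mirror the effect on colourings of the letters a, d, b and c, in this order; for b
    the two swapped places are rotated to the front. *)
Definition pullback_closed (P : seq bool -> seq bool -> Prop) : Prop :=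
  [/\ forall t, preserves_rot (P^~ t), forall s, preserves_rot (P s),
      forall x y s z w t,
        P (x :: y :: s) (z :: w :: t) -> P (y :: x :: s) (w :: z :: t)
    & forall x y s z w t,
        P (x :: y :: s) (z :: w :: t) -> P (x :: x :: s) (z :: z :: t)].

Lemma pullback_closed_flip P :
  pullback_closed P -> pullback_closed (fun t s => P s t).
Proof. by case=> rotl rotr sw cp; split=> // x y s z w t; [move/sw | move/cp]. Qed.

Lemma pullback_closed_perm P s s' t :
  pullback_closed P -> 1 < size t -> perm_eq s s' -> P s t -> P s' t.
Proof.
case=> rotl rotr sw _; case: t => [|u [|v t]] // _.
(* Two swaps with a rotation of [s] between them cancel on [t] and leave a 3-cycle of [s]. *)
have cyc x y z l : P (x :: y :: z :: l) [:: u, v & t] ->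
    P (y :: z :: x :: l) [:: u, v & t].
  move=> /sw /rotl; rewrite /rot /= => /sw.
  exact: (@preserves_rot_cat _ [:: z, x & l] [:: y] (rotl _)).
apply: (@preserves_perm (P^~ _) _ _ (rotl _)) => x y [|z l] Pl; first exact: rotl Pl.
(* Two of three booleans agree, so the identity, the 3-cycle or its square has the effect of
   swapping [x] and [y]. *)
case: x y z Pl => [] [] [] Pl; do ?[done | exact: cyc | exact/cyc/cyc].
Qed.

Lemma bool_pigeonhole (t : seq bool) :
  2 < size t -> exists z t', perm_eq t (z :: z :: t').
Proof.
case: t => [|x [|y [|z t]]] // _.
have [<-|nxy] := eqVneq x y; first by exists x, (z :: t).
have [->|nxz] := eqVneq z x.
  exists x, (y :: t); apply/permP=> a /=; lia.
have -> : z = y by case: x y z nxy nxz => [] [] [].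
by exists y, (x :: t); apply/permP=> a /=; lia.
Qed.

(** Once [t] is permuted to begin with two equal letters, the copying clause changes [s] only; then
    [t] is permuted back. *)
Lemma pullback_closed_copy P x y s t :
  pullback_closed P -> 2 < size t -> P (x :: y :: s) t -> P (x :: x :: s) t.
Proof.
move=> clP t3; have [z [t' tz]] := bool_pigeonhole t3.
have permP' a r r' :=
  @pullback_closed_perm _ r r' [:: x, a & s] (pullback_closed_flip clP) isT.
move=> /(permP' _ _ _ tz); case: (clP) => _ _ _ cp /cp.
by apply: permP'; rewrite perm_sym.
Qed.

(** One [true] and one [false] are kept in front as sources while the other letters are overwritten
    one by one; the two sources themselves are adjusted last. *)
Lemma pullback_closed_left P s s' t :
  pullback_closed P -> true \in s -> false \in s -> size s = size s' ->
  2 < size t -> P s t -> P s' t.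
Proof.
move=> clP s1 s0 szs t3 Ps; have t2 := ltnW t3.
have permP' r r' := @pullback_closed_perm P r r' t clP t2.
(* Here [r] collects the letters that are already overwritten. *)
have rewP l l' r : size l = size l' ->
    P (true :: false :: l ++ r) t -> P (true :: false :: l' ++ r) t.
  elim: l l' r => [|y l IH] [|b l'] r //= [szl] Pl.
  have Pb : P [:: b, y, ~~ b & l ++ r] t.
    by apply: permP' Pl; apply/permP=> a; case: (b) => /=; lia.
  have := pullback_closed_copy clP t3 Pb => {}Pb.
  have {}Pb : P [:: true, false & l ++ b :: r] t.
    by apply: permP' Pb; apply/permP=> a; case: (b) => /=; rewrite !count_cat /=; lia.
  apply: permP' (IH _ _ szl Pb); apply/permP=> a /=; rewrite !count_cat /=; lia.
have [l sl] : exists l, perm_eq s [:: true, false & l].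
  exists (rem false (rem true s)).
  rewrite (perm_trans (perm_to_rem s1)) // perm_cons perm_to_rem //.
  by move: s0; rewrite (perm_mem (perm_to_rem s1)).
have szl := perm_size sl; case: s' szs => [|x [|y l']] szs; try by rewrite szs in szl.
have {}szl : size l = size l' by move: szs; rewrite szl => -[].
have Pl := rewP _ _ [::] szl; rewrite !cats0 in Pl.
have {Pl} Px : P [:: x, ~~ x & l'] t.
  by apply: permP' (Pl (permP' _ _ sl Ps)); apply/permP=> a; case: (x) => /=; lia.
have [->|nxy] := eqVneq y x; first exact: pullback_closed_copy Px.
by have -> : y = ~~ x by case: x y nxy {Px szs} => [] [].
Qed.

Lemma pullback_closed_total P s t s' t' :
  pullback_closed P -> P s t ->
  true \in s -> false \in s -> true \in t -> false \in t ->
  2 < size s -> 2 < size t -> size s = size s' -> size t = size t' -> P s' t'.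
Proof.
move=> clP Pst s1 s0 t1 t0 s3 t3 szs szt.
apply: (pullback_closed_left (pullback_closed_flip clP) t1 t0 szt); rewrite -?szs //.
exact: pullback_closed_left Pst.
Qed.

(** * Acceptance in D through colourings of rows and columns *)

Definition colB n w j := foldl (wnat n La Lb Lc Ld) j w == n - 1.
Definition colC p w j := foldl (wnat p Ld Lb Lc La) j w == p - 1.

(* A pair (q_0,r_0) added after a letter of w is accepted by what follows. *)
Fixpoint late m n p i w : bool :=
  if w is x :: w' then
    let i' := wnat m La Lc Lb Ld i x in
    (i' == m - 1) && (colB n w' 0 (+) colC p w' 0) || late m n p i' w'
  else false.

Lemma Dfinal_run m n p (st : Dstate m n p) w : 0 < n -> 0 < p ->
  Dfinal (Drun st w) =
    [exists u in st.2, colB n w (val u.1) (+) colC p w (val u.2)]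
    || late m n p (val st.1) w.
Proof.
move=> n0 p0; elim: w st => [|x w IH] st /=; first by rewrite orbF.
rewrite IH /= -/(Wfinal (dA st.1 x)) orbA; congr orb.
have imP : [exists u in [set (dB u.1 x, dC u.2 x) | u in st.2],
      colB n w (val u.1) (+) colC p w (val u.2)] =
    [exists u in st.2, colB n (x :: w) (val u.1) (+) colC p (x :: w) (val u.2)].
  apply/exists_inP/exists_inP => [[_ /imsetP[u Su ->] Hu]|[u Su Hu]].
    by exists u.
  by exists (dB u.1 x, dC u.2 x) => //; apply: imset_f.
rewrite -imP; case: (Wfinal _) => /=; last by rewrite orbF.
apply/exists_inP/orP => [[u /setUP[Su|Su] Hu]|[/exists_inP[u Su Hu]|H0]].
- by left; apply/exists_inP; exists u.
- by move: Su; rewrite inE => /andP[/eqP u1 /eqP u2]; right; rewrite u1 u2 in Hu.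
- by exists u => //; rewrite inE Su.
by exists (Ordinal n0, Ordinal p0) => //; rewrite !inE orbT.
Qed.

(** * Separating states with different levels of A *)

Lemma wnat_cycle_iter k x1 x2 x3 x4 l j :
  j < k -> foldl (wnat k x1 x2 x3 x4) j (nseq l x1) = (j + l) %% k.
Proof.
move=> jk; elim: l j jk => [|l IH] j jk /=; first by rewrite addn0 modn_small.
by rewrite IH ?wnat_lt // /wnat eqxx modnDml addSnnS.
Qed.

Lemma wnat_id_iter k x1 x2 x3 x4 l j :
  x4 != x1 -> x4 != x2 -> x4 != x3 -> foldl (wnat k x1 x2 x3 x4) j (nseq l x4) = j.
Proof.
move=> /negPf n1 /negPf n2 /negPf n3.
by elim: l j => [|l IH] j //=; rewrite IH /wnat n1 n2 n3 eqxx.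
Qed.

Lemma wnat_inj k x1 x2 x3 x4 x i j : x != x3 -> i < k -> j < k ->
  wnat k x1 x2 x3 x4 i x = wnat k x1 x2 x3 x4 j x -> i = j.
Proof.
rewrite /wnat => /negPf-> ik jk; case: (x == x1).
  move=> /eqP; rewrite -(addn1 i) -(addn1 j) eqn_modDr !modn_small // => /eqP; exact.
case: (x == x2); last by case: ifP.
by do ![case: eqP]; lia.
Qed.

(** Along d^(p-2) only column 1 reaches the final state of C, and c has just emptied it; meanwhile
    row n-1 stays final in B. *)
Definition tail p := Lc :: nseq (p - 2) Ld.

Lemma colB_tail n p l j : 2 < n -> j < n ->
  colB n (nseq l La ++ tail p) j = ((j + l) %% n == n - 1).
Proof.
move=> hn jn; rewrite /colB foldl_cat wnat_cycle_iter //= wnat_id_iter //.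
rewrite /wnat /=; case: ifP => // /eqP ->; lia.
Qed.

Lemma colC_tail p l j : 2 < p -> j < p -> colC p (nseq l La ++ tail p) j = false.
Proof.
move=> hp jp; rewrite /colC foldl_cat wnat_id_iter //= wnat_cycle_iter ?wnat_lt //.
rewrite /wnat /=; have [_|j1] := eqVneq j 1; first by rewrite modn_small; lia.
have [j0|j2] := leqP j 0; first by rewrite modn_small; lia.
have -> : j + (p - 2) = (j - 2) + p by lia.
by rewrite modnDr modn_small; lia.
Qed.

Lemma late_tail m n p i : 2 < n -> 2 < p -> late m n p i (tail p) = false.
Proof.
move=> hn hp.
(* A pair added while the letters d are read ends in row 0 and in a column below p-1. *)
suff H l i' : l <= p - 2 -> late m n p i' (nseq l Ld) = false.
  rewrite /= H // orbF; have := @colB_tail n p 0 0 hn; have := @colC_tail p 0 0 hp.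
  rewrite /tail /colB /colC /= !add0n mod0n => -> ; last lia.
  by move=> -> ; [rewrite (_ : 0 == n - 1 = false) ?andbF //; lia | lia].
elim: l i' => [|l IH] i' //= lp; rewrite IH ?orbF; last lia.
rewrite /colB /colC wnat_id_iter // wnat_cycle_iter; last lia.
by rewrite modn_small; lia.
Qed.


(** A pair added with l' letters a left is accepted iff l' is n-1 modulo n; since l' < 2n-1, only l'
    = n-1 qualifies, which happens after l-n+1 letters. *)
Lemma late_cycle_tail m n p l i : 2 < n -> 2 < p -> l < n.*2 ->
  late m n p i (nseq l La ++ tail p) =
    (n <= l) && (foldl (wnat m La Lc Lb Ld) i (nseq (l - n).+1 La) == m - 1).
Proof.
move=> hn hp; elim: l i => [|l IH] i ln; first by rewrite late_tail //; lia.
rewrite /= IH; last lia.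
rewrite colB_tail ?colC_tail ?addbF ?add0n; try lia.
have [l1|l1] := ltnP l (n - 1); first by rewrite modn_small; lia.
have [l2|l2] := ltnP l n.
  have -> : l = n - 1 by lia.
  rewrite modn_small ?eqxx; last lia.
  have [-> ->] : n <= (n - 1).+1 /\ (n - 1).+1 - n = 0 by lia.
  by rewrite andbT orbF.
have -> : l %% n == n - 1 = false.
  by rewrite -(subnK l2) modnDr modn_small; lia.
by rewrite andbF leqW // subSn.
Qed.

(* Two runs of a^(n-1) in a row: the first moves the emptied row 1 to row 0, the
   second moves row 0 to row n-1. *)
Definition separator n p k :=
  nseq k La ++ Lc :: nseq (n - 1).*2 La ++ tail p.

(** The 2(n-1) letters a lead only row 1 to row n-1, and c has just emptied row 1. *)
Lemma colB_separator n p k j : 2 < n -> j < n -> colB n (separator n p k) j = false.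
Proof.
move=> hn jn; rewrite /colB foldl_cat wnat_cycle_iter //= -/(colB n _ _).
rewrite colB_tail ?wnat_lt ?ltn_pmod //; try lia.
have: wnat n La Lb Lc Ld ((j + k) %% n) Lc != 1.
  by rewrite /wnat /=; case: ifP => // ->.
have: wnat n La Lb Lc Ld ((j + k) %% n) Lc < n by apply/wnat_lt/ltn_pmod; lia.
case: (wnat _ _ _ _ _ _ _) => [|[|i]] // ni _.
  by rewrite add0n (_ : _.*2 = n - 2 + n) ?modnDr ?modn_small; lia.
by rewrite (_ : _ + _ = i + n + n) ?modnDr ?modn_small; lia.
Qed.

Lemma colC_separator n p k j : 2 < p -> j < p -> colC p (separator n p k) j = false.
Proof.
move=> hp jp; rewrite /colC foldl_cat wnat_id_iter //= -/(colC p _ _).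
by rewrite colC_tail ?wnat_lt.
Qed.

Lemma late_separator m n p k i : 2 < n -> 2 < p ->
  late m n p i (separator n p k) =
    (foldl (wnat m La Lc Lb Ld) i (nseq k La ++ Lc :: nseq (n - 1) La) == m - 1).
Proof.
move=> hn hp; elim: k i => [|k IH] i.
  rewrite /separator /= late_cycle_tail //; last lia.
  rewrite colB_tail ?colC_tail ?addbF ?add0n; try lia.
  rewrite (_ : _.*2 = n - 2 + n) ?modnDr ?modn_small; try lia.
  rewrite addnK leq_addl (_ : n - 2 == _ = false) ?andbF; try lia.
  by rewrite (_ : (n - 2).+1 = n - 1); lia.
rewrite [LHS]/= -/(separator n p k) IH.
by rewrite colB_separator ?colC_separator ?andbF; try lia.
Qed.

Lemma cycle_word_inj m w i j :
  Lb \notin w -> i < m -> j < m ->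
  foldl (wnat m La Lc Lb Ld) i w = foldl (wnat m La Lc Lb Ld) j w -> i = j.
Proof.
elim: w i j => //= x w IH i j; rewrite inE negb_or => /andP[xb wb] im jm.
move=> /(IH _ _ wb (wnat_lt _ _ _ _ _ im) (wnat_lt _ _ _ _ _ jm)).
by apply: wnat_inj; rewrite // eq_sym.
Qed.

Lemma separate_levels m n p (st1 st2 : Dstate m n p) : 2 < n -> 2 < p ->
  st1.1 != st2.1 -> exists w, Dfinal (Drun st1 w) != Dfinal (Drun st2 w).
Proof.
move=> hn hp ne; set i1 := st1.1; have m0 : 0 < m := leq_ltn_trans (leq0n _) (ltn_ord i1).
pose u k := nseq k La ++ Lc :: nseq (n - 1) La.
have [k uk] : exists k, foldl (wnat m La Lc Lb Ld) i1 (u k) = m - 1.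
  pose f (i : 'I_m) := foldl (@dA m) i (u 0).
  have valf i : val (f i) = foldl (wnat m La Lc Lb Ld) i (u 0).
    by rewrite /f; elim: (u 0) i => //= x w IH i; rewrite IH.
  have injf : injective f.
    move=> i j /(congr1 val); rewrite !valf => /cycle_word_inj => H.
    by apply/val_inj/H; rewrite // inE mem_nseq andbF.
  have m1 : m - 1 < m by rewrite subn1 prednK.
  pose t := invF injf (Ordinal m1).
  (* These letters a bring [i1] to [t], the preimage of the final level under c a^(n-1). *)
  exists (t + (m - i1)); rewrite foldl_cat wnat_cycle_iter //.
  have -> : (i1 + (t + (m - i1))) %% m = t.
    rewrite addnCA subnKC; last exact/ltnW/ltn_ord.
    by rewrite modnDr modn_small.
  by have := congr1 val (f_invF injf (Ordinal m1)); rewrite valf.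
have run0 (st : Dstate m n p) : Dfinal (Drun st (separator n p k)) =
    (foldl (wnat m La Lc Lb Ld) (val st.1) (u k) == m - 1).
  rewrite Dfinal_run ?late_separator //; try lia.
  case: exists_inP => // -[v _].
  by rewrite colB_separator ?colC_separator ?ltn_ord.
exists (separator n p k); rewrite !run0 uk eqxx; apply: contra ne => /eqP/esym/eqP u2.
apply/eqP/val_inj/(@cycle_word_inj m (u k)); rewrite ?ltn_ord ?uk ?u2 //.
by rewrite mem_cat inE !mem_nseq !andbF.
Qed.

(** * Colourings obtained as pullbacks from each level *)

(** Every pair added along [w] gets equal colours, so acceptance of [w] from level [i] depends only
    on the tableau present at the start. *)
Definition reach m n p i (s t : seq bool) : Prop :=
  exists w, [/\ s = mkseq (colB n w) n, t = mkseq (colC p w) p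
              & late m n p i w = false].

Lemma mkseq_cycle (F : nat -> bool) k :
  mkseq (fun j => F (j.+1 %% k)) k = rot 1 (mkseq F k).
Proof.
case: k => // k; rewrite /mkseq [RHS]/= rot1_cons -cats1.
have -> : iota 0 k.+1 = iota 0 k ++ [:: k] by rewrite -addn1 iotaD.
rewrite map_cat /= modnn; congr cat.
rewrite (iotaDl 1 0) -map_comp; apply/eq_in_map => j; rewrite mem_iota => /andP[_ jk].
by rewrite /= modn_small.
Qed.

Lemma mkseq_swap (F : nat -> bool) k l x y :
  mkseq F k = l ++ [:: x; y] ->
  mkseq (fun j => F (if j == k - 2 then k - 1 else if j == k - 1 then k - 2 else j)) k
    = l ++ [:: y; x].
Proof.
move=> E; have := congr1 size E; rewrite size_mkseq size_cat /= => Ek.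
have nthF j : j < k -> F j = nth false (l ++ [:: x; y]) j.
  by move=> jk; rewrite -E nth_mkseq.
apply: (@eq_from_nth _ false); rewrite size_mkseq ?size_cat // => j jk.
rewrite nth_mkseq // nthF; last by do ![case: ifP] => *; lia.
rewrite !nth_cat.
have [->|j2] := eqVneq j (k - 2).
  have -> : k - 1 = (size l).+1 by lia.
  have -> : k - 2 = size l by lia.
  by rewrite !ltnNge leqnSn leqnn subnn subSnn.
have [->|j1] := eqVneq j (k - 1).
  have -> : k - 1 = (size l).+1 by lia.
  have -> : k - 2 = size l by lia.
  by rewrite !ltnNge leqnSn leqnn subnn subSnn.
by have -> : j < size l by lia.
Qed.

Lemma mkseq_copy (F : nat -> bool) k x y s :
  mkseq F k = x :: y :: s ->
  mkseq (fun j => F (if j == 1 then 0 else j)) k = x :: x :: s.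
Proof.
case: k => [|[|k]] // [<- _ <-]; congr [:: _, _ & _].
by apply/eq_in_map => j; rewrite mem_iota; case: eqP => // ->.
Qed.

Lemma mkseq_colB_a n w : mkseq (colB n (La :: w)) n = rot 1 (mkseq (colB n w) n).
Proof. exact: mkseq_cycle. Qed.

Lemma mkseq_colC_a p w : mkseq (colC p (La :: w)) p = mkseq (colC p w) p.
Proof. by []. Qed.

Lemma mkseq_colC_d p w : mkseq (colC p (Ld :: w)) p = rot 1 (mkseq (colC p w) p).
Proof. exact: mkseq_cycle. Qed.

Lemma reach_a m n p i s t : i < m -> i.+1 %% m != m - 1 ->
  reach m n p (i.+1 %% m) s t -> reach m n p i (rot 1 s) t.
Proof.
move=> im /negPf ne [w [-> -> lw]]; exists (La :: w); split=> //.
  by rewrite mkseq_colB_a.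
by rewrite /= /wnat /= ne.
Qed.

Lemma reach_d m n p i s t : i != m - 1 -> reach m n p i s t -> reach m n p i s (rot 1 t).
Proof.
move=> /negPf ne [w [-> -> lw]]; exists (Ld :: w); split=> //.
  by rewrite mkseq_colC_d.
by rewrite /= /wnat /= ne.
Qed.

Lemma reach_b m n p i j l1 x1 y1 l2 x2 y2 :
  j = wnat m La Lc Lb Ld i Lb -> j != m - 1 ->
  reach m n p j (l1 ++ [:: x1; y1]) (l2 ++ [:: x2; y2]) ->
  reach m n p i (l1 ++ [:: y1; x1]) (l2 ++ [:: y2; x2]).
Proof.
move=> ji /negPf ne [w [Es Et lw]]; exists (Lb :: w); split.
- by rewrite -(mkseq_swap (esym Es)).
- by rewrite -(mkseq_swap (esym Et)).
by rewrite /= -ji ne.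
Qed.

Lemma reach_c m n p i x1 y1 l1 x2 y2 l2 : i < m - 2 ->
  reach m n p i (x1 :: y1 :: l1) (x2 :: y2 :: l2) ->
  reach m n p i (x1 :: x1 :: l1) (x2 :: x2 :: l2).
Proof.
move=> im [w [Es Et lw]]; exists (Lc :: w); split.
- by rewrite -(mkseq_copy (esym Es)).
- by rewrite -(mkseq_copy (esym Et)).
rewrite /= (_ : wnat m La Lc Lb Ld i Lc = i) ?lw ?ifF //; first by lia.
by rewrite /wnat /=; do ![case: eqP]; lia.
Qed.


Lemma size_reach m n p i s t : reach m n p i s t -> size s = n /\ size t = p.
Proof. by case=> w [-> -> _]; rewrite !size_mkseq. Qed.

Lemma last_two (s : seq bool) : 1 < size s -> exists l x y, s = l ++ [:: x; y].
Proof.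
case/lastP: s => // s y; rewrite size_rcons; case/lastP: s => // s x _.
by exists s, x, y; rewrite -!cats1 -catA.
Qed.

(** Reading b twice moves A from 1 to 0 and keeps it there, while the two swaps cancel on B and
    C. *)
Lemma reach1 m n p s t : 2 < m -> 1 < n -> 1 < p ->
  reach m n p 0 s t -> reach m n p 1 s t.
Proof.
move=> hm hn hp R0; have [sn tp] := size_reach R0.
rewrite -sn in hn; rewrite -tp in hp.
have [l1 [x1 [y1 E1]]] := last_two hn; have [l2 [x2 [y2 E2]]] := last_two hp.
have b0 : 0 = wnat m La Lc Lb Ld 0 Lb by [].
have b1 : 0 = wnat m La Lc Lb Ld 1 Lb by [].
have m0 : 0 != m - 1 by lia.
rewrite E1 E2 in R0 *; exact: (reach_b b1 m0) (reach_b b0 m0 R0).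
Qed.

(* In level 0 the word abb acts as a, b b cancelling on both B and C, while it
   brings A back to 0 without visiting its final state. *)
Lemma reach0_closed m n p : 2 < m -> 1 < n -> 1 < p ->
  pullback_closed (reach m n p 0).
Proof.
move=> hm hn hp; have m0 : 0 != m - 1 by lia.
have b0 : 0 = wnat m La Lc Lb Ld 0 Lb by [].
have rotl t : preserves_rot ((reach m n p 0)^~ t).
  move=> s R0; apply: reach_a; rewrite ?modn_small; try lia.
  exact: reach1.
have rotr s : preserves_rot (reach m n p 0 s) by move=> t; apply: reach_d.
split=> // x y s z w t; last by apply: reach_c; lia.
(* The first two entries of both words are rotated to the end, where b swaps them, and back. *)
move=> /(preserves_rot_cat (s1 := [:: x; y]) (rotl _)).
move=> /(preserves_rot_cat (s1 := [:: z; w]) (rotr _)) /(reach_b b0 m0).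
move=> /(preserves_rot_cat (rotl _)) /(preserves_rot_cat (rotr _)); exact.
Qed.

Lemma mem_mkseq_last k c : 1 < k -> c \in mkseq (fun j => j == k - 1) k.
Proof.
move=> k1; apply/mapP; exists (if c then k - 1 else 0); last by case: c; lia.
by rewrite mem_iota; case: c; lia.
Qed.

Lemma reach0_total m n p s t : 2 < m -> 2 < n -> 2 < p ->
  size s = n -> size t = p -> reach m n p 0 s t.
Proof.
move=> hm hn hp sn tp.
pose init k := mkseq (fun j => j == k - 1) k.
have R0 : reach m n p 0 (init n) (init p) by exists [::].
apply: (pullback_closed_total _ R0); rewrite ?mem_mkseq_last ?size_mkseq //; try lia.
by apply: reach0_closed; lia.
Qed.

Lemma reach_final m n p s t : 2 < m -> 2 < n -> 2 < p ->
  size s = n -> size t = p -> reach m n p (m - 1) s t.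
Proof.
move=> hm hn hp sn tp; rewrite -[s](rotrK 1); have E : (m - 1).+1 %% m = 0.
  by rewrite (_ : (m - 1).+1 = m) ?modnn; lia.
apply: reach_a; rewrite ?E; try lia.
by apply: reach0_total; rewrite ?size_rotr.
Qed.

(** The letter a enters the final level and turns the last row, of colour [x], into row 0; letters d
    read before it turn a column of colour [x] into column 0, so the added pair gets equal
    colours. *)
Lemma reach_before_final m n p (s t : seq bool) x : 2 < m -> 2 < n -> 2 < p ->
  (size s).+1 = n -> size t = p -> x \in t -> reach m n p (m - 2) (rcons s x) t.
Proof.
move=> hm hn hp sn tp /rot_to[k t' Et].
have rotd : preserves_rot (reach m n p (m - 2) (rcons s x)).
  by move=> r; apply: reach_d; lia.
rewrite -(rotK k t) Et; apply: preserves_rotn => // {rotd}.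
have tp' : (size t').+1 = p by rewrite -tp -(size_rot k t) Et.
have [w [Es Et' lw]] : reach m n p (m - 1) (x :: s) (x :: t') by apply: reach_final.
exists (La :: w); rewrite mkseq_colB_a mkseq_colC_a -Es -Et' rot1_cons; split=> //.
have E : wnat m La Lc Lb Ld (m - 2) La = m - 1.
  by rewrite /wnat /= (_ : (m - 2).+1 = m - 1) ?modn_small; lia.
rewrite /= E lw eqxx orbF /=.
have -> : colB n w 0 = x by rewrite -(nth_mkseq false (colB n w) (n := n)) -?Es //; lia.
have -> : colC p w 0 = x by rewrite -(nth_mkseq false (colC p w) (n := p)) -?Et' //; lia.
exact: addbb.
Qed.

(* At these levels A must visit its final state on its way to 0, and the row and
   column then numbered 0 must have equal colours.  The letter b offers two
   rows for this, and d any column. *)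
Lemma reach_middle m n p i (s t : seq bool) : 2 < n -> 2 < p -> 1 < i -> i < m - 1 ->
  size s = n -> size t = p -> count (fun x => x \notin t) s <= 1 ->
  reach m n p i s t.
Proof.
move=> hn hp i1; have [k Ek] := ubnP (m - 2 - i).
elim: k i i1 Ek s => // k IH i i1 Ek s im sn tp cs.
have [i2|i2] := eqVneq i (m - 2); last first.
  have Ei : i.+1 %% m = i.+1 by rewrite modn_small; lia.
  rewrite -[s](rotrK 1); apply: reach_a; rewrite ?Ei; try lia.
  apply: IH; rewrite ?size_rotr //; try lia.
  by rewrite (permP (_ : perm_eq (rotr 1 s) s)) // perm_rotr.
have [l [x [y Es]]] : exists l x y, s = l ++ [:: x; y] by apply: last_two; rewrite (sn, tp); lia.
have [t' [z [w Et]]] : exists l x y, t = l ++ [:: x; y] by apply: last_two; rewrite (sn, tp); lia.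
have memt : t' ++ [:: w; z] =i t.
  by move=> u; rewrite Et !mem_cat !inE orbCA [in LHS]orbC -!orbA; do ![case: (_ \in _) | case: (_ == _)].
have cat2 u v : l ++ [:: u; v] = rcons (rcons l u) v by rewrite -!cats1 -catA.
have szl : (size l).+2 = n by rewrite -sn Es size_cat addn2.
have [yt|yt] := boolP (y \in t).
  by rewrite i2 Es cat2; apply: reach_before_final; rewrite ?size_rcons //; lia.
(* Row [y] is already the one exception allowed by the count. *)
have xt : x \in t by move: cs; rewrite Es count_cat /= yt; case: (x \in t) => //=; lia.
have bi : i = wnat m La Lc Lb Ld i Lb by rewrite /wnat /=; case: eqP => //; lia.
rewrite Es [t]Et; apply: (reach_b bi); first by lia.
rewrite i2 cat2; apply: reach_before_final; rewrite ?size_rcons ?memt //; try lia.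
by rewrite -tp Et !size_cat.
Qed.

Lemma reach_total m n p i (s t : seq bool) : 2 < m -> 2 < n -> 2 < p -> i < m ->
  size s = n -> size t = p -> count (fun x => x \notin t) s <= 1 ->
  reach m n p i s t.
Proof.
move=> hm hn hp im sn tp cs.
have [->|i0] := eqVneq i 0; first exact: reach0_total.
have [->|i1] := eqVneq i 1.
  by apply: reach1; [| exact: ltnW | exact: ltnW | exact: reach0_total].
have [->|i2] := eqVneq i (m - 1); first exact: reach_final.
by apply: reach_middle => //; lia.
Qed.

(** * Separating tableaux at the same level *)

(* The last clause makes [reach_total] applicable; it forces the special choice
   of f when q lies in no pair of S. *)
Lemma saturated_colouring n p (S : {set 'I_n * 'I_p}) q r :
  saturated S -> (q, r) \notin S ->
  exists (f : 'I_n -> bool) (g : 'I_p -> bool),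
    [/\ forall u, u \in S -> f u.1 = g u.2, f q != g r
      & forall x, x != q -> exists y, f x = g y].
Proof.
move=> satS qrS; pose g y := (q, y) \in S.
have gr : g r = false by apply/negbTE.
have [/existsP[y1 gy1]|/existsPn g0] := boolP [exists y, g y].
  (* Coloured [true] are the columns meeting row [q], and the rows equal to [q] or meeting such a
     column; by saturation these rows meet no other columns. *)
  exists (fun x => (x == q) || [exists y, g y && ((x, y) \in S)]), g.
  rewrite eqxx gr; split=> // [[x y] /= xyS|x _]; last by case: (_ || _); [exists y1 | exists r].
  apply/idP/idP => [/orP[/eqP xq|/existsP[z /andP[qz xz]]]|gy].
  - by rewrite /g -xq.
  - exact: satS xyS xz qz.
  by apply/orP; right; apply/existsP; exists y; rewrite gy.
exists (pred1 q), (fun=> false); rewrite /= eqxx; split=> // [[x y] xyS|x /negPf->].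
  by apply/eqP => /= xq; have := g0 y; rewrite /g -xq xyS.
by exists r.
Qed.

Lemma codom_mkseq k (f : 'I_k -> bool) F :
  codom f = mkseq F k -> forall x, f x = F (val x).
Proof.
rewrite /mkseq -val_enum_ord -map_comp codomE => /eq_in_map E x.
by rewrite (E x) ?mem_enum.
Qed.

Lemma separate_tableaux m n p (i : 'I_m) (S1 S2 : {set 'I_n * 'I_p}) :
  2 < m -> 2 < n -> 2 < p -> saturated S2 -> ~~ (S1 \subset S2) ->
  exists w, Dfinal (Drun (i, S1) w) && ~~ Dfinal (Drun (i, S2) w).
Proof.
move=> hm hn hp sat2 /subsetPn[[q r] qr1 qr2].
have [f [g [fgS fgqr fg]]] := saturated_colouring sat2 qr2.
have [w [/codom_mkseq Ef /codom_mkseq Eg lw]] : reach m n p i (codom f) (codom g).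
  apply: reach_total; rewrite ?size_codom ?card_ord //.
  rewrite codomE count_map.
  (* Only row [q] may have a colour that no column has, and [q] is enumerated once. *)
  have := count_uniq_mem q (enum_uniq 'I_n); rewrite mem_enum => cq.
  rewrite (leq_trans _ (eq_leq cq)) //; apply: sub_count => x /=.
  by apply: contraR => /fg[y ->]; exact: codom_f.
exists w; rewrite !Dfinal_run ?lw ?orbF; try lia.
apply/andP; split; first by apply/exists_inP; exists (q, r); rewrite //= -Ef -Eg -negb_eqb.
by apply/exists_inPn => u /fgS; rewrite -Ef -Eg => ->; rewrite addbb.
Qed.

Theorem theorem3 (m n p : nat) (hm : 3 <= m) (hn : 3 <= n) (hp : 3 <= p)
    (st1 st2 : Dstate m n p) :
  st1 <> st2 ->
  saturated st1.2 -> saturated st2.2 ->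
  (Wfinal st1.1 -> init_pair n p \subset st1.2) ->
  (Wfinal st2.1 -> init_pair n p \subset st2.2) ->
  exists w : seq letter, Dfinal (Drun st1 w) != Dfinal (Drun st2 w).
Proof.
case: st1 st2 => [i1 S1] [i2 S2] ne /= sat1 sat2 _ _.
have [i12|ne_i] := eqVneq i1 i2; last exact: separate_levels.
rewrite -i12 in ne *.
have [s12|/(separate_tableaux i1 hm hn hp sat2)[w /andP[D1 D2]]] := boolP (S1 \subset S2).
  have [s21|/(separate_tableaux i1 hm hn hp sat1)[w /andP[D2 D1]]] := boolP (S2 \subset S1).
    by case: ne; congr pair; apply/eqP; rewrite eqEsubset s12.
  by exists w; rewrite D2 (negPf D1).
by exists w; rewrite D1 (negPf D2).
Qed.
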